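(* Let $\mathcal G$ be a Farey-indexed real Markov topograph with all labels $\ge2$, discriminator $D=4$, and not all labels equal to $2$ (so that it has at most one $2$-region). Then $P_{\mathcal G}$ extends uniquely to $\Gamma_{\mathcal G}$, which is a pair of parallel lines, one on each side of the origin.
   Context: A real Markov topograph $\mathcal G$ is an infinite 3-regular tree drawn in the plane, with a real label on every complementary region, such that for every edge, with regions $s,t$ on its two sides and regions $r,u$ at its two ends, $r+u=st$. The discriminator is $D=r^2+s^2+t^2-rst$ for the labels meeting at a vertex (independent of the vertex). A $2$-region is a region with label $2$. Farey indexing: regions are indexed by $\mathbb P^1(\mathbb Q)$, elements written $k/n$ with $\gcd(k,n)=1$, $k/n=(-k)/(-n)$, including $1/0$. One chooses a vertex whose three regions in clockwise order are $(s,u,t)$ and sets $m^*_{1/0}=s$, $m^*_{1/1}=u$, $m^*_{0/1}=t$; if $k/n,k'/n'$ index the two regions on the sides of an edge then the regions at its ends have indices $(k+k')/(n+n')$ and $(k-k')/(n-n')$. $m^*_{k/n}$ is the label of region $k/n$; set $r=m^*_{-1/1}=st-u$. Let $\rho(x)=\cosh^{-1}(x/2)$ for $x\ge2$ and $$P_{\mathcal G}=\left\{\left(\frac n{\rho(|m^*_{k/n}|)},\frac k{\rho(|m^*_{k/n}|)}\right): k,n\in\mathbb Z,\ \gcd(k,n)=1\right\},$$ where points with $\rho(|m^*_{k/n}|)=0$ are regarded as at infinity in the given direction. For $k/n\in\mathbb Q\cap[0,1]$ in lowest terms ($n\ge1$) put $\phi_0(k/n)=\rho(|m^*_{n/k}|)/n$,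 $\phi_1(k/n)=\rho(|m^*_{k/n}|)/n$, $\phi_2(k/n)=\rho(|m^*_{-k/n}|)/n$, $\phi_3(k/n)=\rho(|m^*_{-n/k}|)/n$ (with $m^*_{n/k}=m^*_{-n/k}=m^*_{1/0}$ when $k/n=0/1$). These extend uniquely to continuous functions $\Phi_0,\dots,\Phi_3$ on $[0,1]$ (the encoding functions of the Markov trees with base triples $(s,su-t,u)$, $(t,ut-s,u)$, $(t,rt-s,r)$, $(s,rs-t,r)$ respectively). The lattice curve is $$\Gamma_{\mathcal G}=\pm\left\{\frac{(x,1)}{\Phi_0(x)},\ \frac{(1,x)}{\Phi_1(x)},\ \frac{(-1,x)}{\Phi_2(x)},\ \frac{(x,-1)}{\Phi_3(x)} : x\in[0,1]\right\},$$ omitting points where the denominator is $0$. ''Extends uniquely'' means as a polar curve: there is a unique continuous $R:\mathbb R/2\pi\mathbb Z\to(0,\infty]$ whose value in the direction of $(n,k)$, for $\gcd(k,n)=1$, is the distance from the origin of the corresponding point of $P_{\mathcal G}$, and the finite points $R(\theta)(\cos\theta,\sin\theta)$ make up $\Gamma_{\mathcal G}$. *)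

(* Defs.v *)
From HB Require Import structures.
From mathcomp Require Import all_boot all_order all_algebra.
From mathcomp Require Import all_classical all_reals all_analysis.
From mathcomp Require Import ring lra.

Set Implicit Arguments.
Unset Strict Implicit.
Unset Printing Implicit Defensive.

Import Order.TTheory GRing.Theory Num.Theory.
Import numFieldNormedType.Exports.

Local Open Scope classical_set_scope.
Local Open Scope ring_scope.

(** P^1(Q) is [option rat], with [None] for 1/0. *)
Definition frac (k n : int) : option rat :=
  if n == 0 then None else Some (k%:Q / n%:Q).

Lemma fracNN (k n : int) : frac (- k) (- n) = frac k n.
Proof. by rewrite /frac oppr_eq0 !rmorphN /= invrN mulrNN. Qed.

(** The regions of the Farey-indexed tree are the elements of P^1(Q), and its
    edges are the pairs {k/n, k'/n'} with k n' - k' n = +-1; the regions at the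
    two ends of that edge are (k + k')/(n + n') and (k - k')/(n - n'). *)
Record farey_topograph (R : realType) := FareyTopograph {
  label : option rat -> R ;
  edge_relation : forall k n k' n' : int,
    `|k * n' - k' * n| = 1 ->
    label (frac (k + k') (n + n')) + label (frac (k - k') (n - n')) =
    label (frac k n) * label (frac k' n') }.

Section Definitions.
Context {R : realType}.
Implicit Types (G : farey_topograph R) (k n : int) (x : R).

Definition mstar G k n : R := label G (frac k n).

Definition vertex_disc (r s t : R) : R :=
  r ^+ 2 + s ^+ 2 + t ^+ 2 - r * s * t.

Definition discriminator G : R :=
  vertex_disc (mstar G 1 1) (mstar G 1 0) (mstar G 0 1).

(** The two ends of an edge give the same value, so that [discriminator] does
    not depend on the choice of the base vertex. *)
Lemma vertex_disc_edge G (k n k' n' : int) : `|k * n' - k' * n| = 1 ->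
  vertex_disc (mstar G (k + k') (n + n')) (mstar G k n) (mstar G k' n') =
  vertex_disc (mstar G (k - k') (n - n')) (mstar G k n) (mstar G k' n').
Proof.
move=> /(edge_relation G); rewrite -!/(mstar _ _ _) => /(canRL (addrK _)) ->.
by rewrite /vertex_disc; ring.
Qed.

Definition cosh x : R := (expR x + expR (- x)) / 2.

Definition arcosh x : R := ln (x + Num.sqrt (x ^+ 2 - 1)).

Lemma arcosh_ge0 x : 1 <= x -> 0 <= arcosh x.
Proof.
move=> x1; rewrite /arcosh ln_ge0 //.
by rewrite (le_trans x1)// lerDl sqrtr_ge0.
Qed.

Lemma arcoshK x : 1 <= x -> cosh (arcosh x) = x.
Proof.
move=> x1; rewrite /cosh /arcosh expRN.
have y0 : 0 <= x ^+ 2 - 1 by rewrite subr_ge0 expr_ge1 // (le_trans ler01).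
have := sqr_sqrtr y0; have := sqrtr_ge0 (x ^+ 2 - 1).
set y := Num.sqrt _ => y_ge0 yE.
have xy : 0 < x + y by lra.
rewrite lnK ?posrE //.
have -> : (x + y)^-1 = x - y.
  apply: (mulfI (lt0r_neq0 xy)); rewrite divff ?lt0r_neq0 //.
  by rewrite mulrC -subr_sqr yE; ring.
by field.
Qed.

Definition rho x : R := arcosh (x / 2).

(** The point of P_G with index k/n, when it is not at infinity. *)
Definition lattice_point G k n : R * R :=
  (n%:~R / rho `|mstar G k n|, k%:~R / rho `|mstar G k n|).

Definition euclidean_norm (p : R * R) : R := Num.sqrt (p.1 ^+ 2 + p.2 ^+ 2).

(** Distance from the origin of the point of P_G with index k/n. *)
Definition lattice_dist G k n : \bar R :=
  if rho `|mstar G k n| == 0 then +oo%E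
  else (euclidean_norm (lattice_point G k n))%:E.

(** [phi G i k n] is phi_i(k/n), for k/n in [0, 1] in lowest terms, n >= 1. *)
Definition phi G (i : 'I_4) k n : R :=
  rho `|match val i with
        | 0%N => mstar G n k
        | 1%N => mstar G k n
        | 2%N => mstar G (- k) n
        | _   => mstar G (- n) k
        end| / n%:~R.

(** Only the values on [0, 1] matter. *)
Definition encoding_functions G (Phi : 'I_4 -> R -> R) : Prop :=
  forall i : 'I_4,
    {within `[0, 1], continuous (Phi i)} /\
    (forall k n, 0 <= k <= n -> 0 < n -> coprimez k n ->
       Phi i (k%:~R / n%:~R) = phi G i k n).

Definition sector (i : 'I_4) x : R * R :=
  match val i with
  | 0%N => (x, 1)
  | 1%N => (1, x)
  | 2%N => (-1, x)
  | _   => (x, -1)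
  end.

Definition lattice_curve (Phi : 'I_4 -> R -> R) : set (R * R) :=
  [set p | exists i : 'I_4, exists2 x : R, 0 <= x <= 1 & Phi i x != 0 /\
    let q := ((sector i x).1 / Phi i x, (sector i x).2 / Phi i x) in
    p = q \/ p = - q].

(** Continuous functions from R / 2 pi Z to ]0, +oo], as periodic functions
    on R. *)
Definition polar_radius (rad : R -> \bar R) : Prop :=
  [/\ continuous rad,
      forall a, rad (a + 2 * pi) = rad a &
      forall a, (0 < rad a)%E].

Definition has_direction (p : R * R) (a : R) : Prop :=
  exists2 c : R, 0 < c & p = (c * cos a, c * sin a).

Definition polar_extension G (rad : R -> \bar R) : Prop :=
  polar_radius rad /\
  (forall k n (a : R), coprimez k n -> has_direction (n%:~R, k%:~R) a ->
     rad a = lattice_dist G k n).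

Definition finite_points (rad : R -> \bar R) : set (R * R) :=
  [set p | exists a d : R, rad a = d%:E /\ p = (d * cos a, d * sin a)].

Definition line (a b c : R) : set (R * R) :=
  [set p | a * p.1 + b * p.2 = c].

(** The origin lies strictly between the two lines a x + b y = c1 and
    a x + b y = c2 when c1 < 0 < c2. *)
Definition parallel_lines_around_origin (C : set (R * R)) : Prop :=
  exists a b c1 c2 : R,
    [/\ (a, b) != (0, 0), c1 < 0 < c2 & C = line a b c1 `|` line a b c2].

End Definitions.

(* Main.v *)
Require Import Defs.
From HB Require Import structures.
From mathcomp Require Import all_boot all_order all_algebra.
From mathcomp Require Import all_classical all_reals all_analysis.
From mathcomp Require Import ring lra zify.

Import Order.TTheory GRing.Theory Num.Theory.
Import numFieldNormedType.Exports.
Local Open Scope classical_set_scope.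
Local Open Scope ring_scope.

(** With s = 2 cosh a the label of 1/0 and t = 2 cosh b that of 0/1, the equation
    D = 4 forces the label of 1/1 to be 2 cosh (a + b), up to the sign of b.
    The edge relation is the addition formula of cosh, so that the label of k/n
    is 2 cosh (k a + n b), and its image by rho is |k a + n b|. The lattice
    points (n, k) / |k a + n b| thus lie on the two lines b x + a y = 1 and
    b x + a y = -1, whose polar radius and encoding functions are explicit.
    Uniqueness follows from the density of rational slopes. *)

(** * Hyperbolic cosine: product formulas and the inverse function *)

Section Cosh.
Context {R : realType}.
Implicit Types x y : R.

Lemma cosh0 : cosh (0 : R) = 1.
Proof. by rewrite /cosh oppr0 expR0; field. Qed.

Lemma coshN x : cosh (- x) = cosh x.
Proof. by rewrite /cosh opprK addrC. Qed.

Lemma cosh_gt0 x : 0 < cosh x.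
Proof. by rewrite /cosh divr_gt0// addr_gt0 ?expR_gt0. Qed.

Lemma mul2cosh x y :
  (2 * cosh x) * (2 * cosh y) = 2 * cosh (x + y) + 2 * cosh (x - y).
Proof. by rewrite /cosh !opprD !expRD opprK; field. Qed.

(** Once s = 2 cosh x and t = 2 cosh y, D = 4 is a quadratic equation in the third label u, with sum
    of roots st and product s^2 + t^2 - 4. By [mul2cosh] and this identity the roots are 2 cosh (x +
    y) and 2 cosh (x - y). *)
Lemma cosh_discriminant x y :
  (2 * cosh x) ^+ 2 + (2 * cosh y) ^+ 2 - 4 =
  (2 * cosh (x + y)) * (2 * cosh (x - y)).
Proof.
rewrite /cosh !opprD !expRD opprK !expRN.
have ? := lt0r_neq0 (expR_gt0 x); have ? := lt0r_neq0 (expR_gt0 y).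
by field; apply/andP.
Qed.

Lemma coshK x : arcosh (cosh x) = `|x|.
Proof.
wlog x0 : x / 0 <= x => [h|].
  case: (leP 0 x) => x0; first by rewrite h // ger0_norm.
  by rewrite -coshN h ?normrN // oppr_ge0 ltW.
rewrite ger0_norm // /arcosh.
have -> : cosh x ^+ 2 - 1 = ((expR x - expR (- x)) / 2) ^+ 2.
  have -> : cosh x ^+ 2 = ((expR x - expR (- x)) / 2) ^+ 2 + expR x * expR (- x).
    by rewrite /cosh; field.
  by rewrite expRxMexpNx_1 addrK.
rewrite sqrtr_sqr ger0_norm; last first.
  by rewrite divr_ge0 // subr_ge0 ler_expR; lra.
have -> : cosh x + (expR x - expR (- x)) / 2 = expR x by rewrite /cosh; field.
exact: expRK.
Qed.

Lemma rho_2cosh x : rho (2 * cosh x) = `|x|.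
Proof. by rewrite /rho mulrC mulKf // coshK. Qed.

Lemma cosh_rho x : 2 <= x -> 2 * cosh (rho x) = x.
Proof. by move=> x2; rewrite /rho arcoshK; [field | lra]. Qed.

End Cosh.

(** * Closed form of the labels when D = 4 *)

Section Labels.
Context {R : realType}.
Implicit Types (f : int -> int -> R) (a b : R).

(** Stated for functions of two integers rather than of a fraction, so that it can be transported
    along linear changes of (k, n) of determinant 1 or -1. *)
Definition edge_rel f := forall k n k' n' : int, `|k * n' - k' * n| = 1 ->
  f (k + k') (n + n') + f (k - k') (n - n') = f k n * f k' n'.

(** Subtractive Euclidean algorithm on (k, n). Each subtraction is absorbed by a shear of [f], which
    moves the base vertex and replaces (a, b) by (a, a + b) or (a + b, b); hence [f], [a], [b] vary
    in the induction. *)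
Lemma cosh_label_nat (k n : nat) : coprime k n -> forall f a b, edge_rel f ->
  f 1 0 = 2 * cosh a -> f 0 1 = 2 * cosh b -> f 1 1 = 2 * cosh (a + b) ->
  f k n = 2 * cosh (k%:R * a + n%:R * b).
Proof.
have [m le_m] := ubnP (k + n)%N.
elim: m => // m IH in k n le_m *.
move=> ckn f a b fE f10 f01 f11.
have [k0|k_gt0] := posnP k.
  by move: ckn; rewrite k0 /coprime gcd0n => /eqP ->; rewrite mul0r mul1r add0r.
have [n0|n_gt0] := posnP n.
  by move: ckn; rewrite n0 /coprime gcdn0 => /eqP ->; rewrite mul0r mul1r addr0.
have [nk|/ltnW kn] := leqP n k.
- have [j kE] : exists j, k = (j + n)%N by exists (k - n)%N; rewrite subnK.
  have cj : coprime j n by move: ckn; rewrite kE coprime_sym /coprime gcdnDr gcdnC.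
  pose f' x y := f (x + y) y.
  have f'E : edge_rel f'.
    move=> k1 n1 k2 n2 d; rewrite -fE; last by rewrite -d; congr (`|_|); ring.
    by congr (f _ _ + f _ _); ring.
  (* The edge between 1/1 and 1/0 has the regions 2/1 and 0/1 at its ends, and the label of 0/1 is
     known. *)
  have f21 : f' 1 1 = 2 * cosh (a + (a + b)).
    apply: (addIr (f 0 1)); rewrite (fE 1 1 1 0) // f11 f10 mul2cosh f01.
    by congr (_ * cosh _ + _ * cosh _); ring.
  rewrite kE PoszD (_ : f _ _ = f' j n) // (IH _ _ _ cj f' a (a + b)) //; last by lia.
  by congr (_ * cosh _); rewrite natrD; ring.
- have [j nE] : exists j, n = (k + j)%N by exists (n - k)%N; rewrite subnKC.
  have cj : coprime k j by move: ckn; rewrite nE /coprime gcdnDl.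
  pose f' x y := f x (x + y).
  have f'E : edge_rel f'.
    move=> k1 n1 k2 n2 d; rewrite -fE; last by rewrite -d; congr (`|_|); ring.
    by congr (f _ _ + f _ _); ring.
  have f12 : f' 1 1 = 2 * cosh ((a + b) + b).
    apply: (addIr (f 1 0)); rewrite (fE 1 1 0 1) // f11 f01 mul2cosh f10.
    by congr (_ * cosh _ + _ * cosh _); ring.
  rewrite nE PoszD (_ : f _ _ = f' k j) // (IH _ _ _ cj f' (a + b) b) //; last by lia.
  by congr (_ * cosh _); rewrite natrD; ring.
Qed.

(** The reflection [f'] reverses the sign of n and of [b], and reduces opposite signs of k and n to
    the natural case; a common sign is removed by the symmetry of [f] or of cosh. *)
Lemma cosh_label (k n : int) f a b : coprimez k n -> edge_rel f ->
  (forall x y, f (- x) (- y) = f x y) ->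
  f 1 0 = 2 * cosh a -> f 0 1 = 2 * cosh b -> f 1 1 = 2 * cosh (a + b) ->
  f k n = 2 * cosh (k%:~R * a + n%:~R * b).
Proof.
rewrite coprimezE => ckn fE fN f10 f01 f11.
pose f' x y := f x (- y).
have f'E : edge_rel f'.
  move=> k1 n1 k2 n2 d; rewrite -fE /f'; last first.
    by rewrite -d -normrN; congr (`|_|); ring.
  by congr (f _ _ + f _ _); ring.
have f'01 : f' 0 1 = 2 * cosh (- b) by rewrite /f' -fN opprK coshN.
have f'11 : f' 1 1 = 2 * cosh (a - b).
  by apply: (addrI (f 1 1)); rewrite (fE 1 0 0 1) // f10 f01 mul2cosh f11.
case: k n ckn => k [] n; rewrite ?NegzE ?abszN !absz_nat => ckn.
- by rewrite (cosh_label_nat _ _ ckn _ _ _ fE f10 f01 f11).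
- rewrite (_ : f _ _ = f' k n.+1) // (cosh_label_nat _ _ ckn _ _ _ f'E f10 f'01 f'11).
  by congr (_ * cosh _); rewrite rmorphN /=; ring.
- rewrite -fN opprK (_ : f _ _ = f' k.+1 n) // (cosh_label_nat _ _ ckn _ _ _ f'E f10 f'01 f'11).
  by rewrite -coshN; congr (_ * cosh _); rewrite rmorphN /=; ring.
- rewrite fN (cosh_label_nat _ _ ckn _ _ _ fE f10 f01 f11).
  by rewrite -coshN; congr (_ * cosh _); rewrite !rmorphN /=; ring.
Qed.

Lemma disc4_label (G : farey_topograph R) :
  2 <= mstar G 1 0 -> 2 <= mstar G 0 1 -> discriminator G = 4 ->
  exists a b, forall k n : int, coprimez k n ->
    mstar G k n = 2 * cosh (k%:~R * a + n%:~R * b).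
Proof.
move=> s2 t2 D4; set a := rho (mstar G 1 0); set b := rho (mstar G 0 1).
have sE : mstar G 1 0 = 2 * cosh a by rewrite cosh_rho.
have tE : mstar G 0 1 = 2 * cosh b by rewrite cosh_rho.
(* [rho] only determines b up to sign; the sign is chosen according to which root of the quadratic
   the label of 1/1 is. *)
have [b' tE' uE] : exists2 b', mstar G 0 1 = 2 * cosh b' &
    mstar G 1 1 = 2 * cosh (a + b').
  have : (mstar G 1 1 - 2 * cosh (a + b)) * (mstar G 1 1 - 2 * cosh (a - b)) = 0.
    have := cosh_discriminant a b; have := mul2cosh a b.
    move: D4; rewrite /discriminator /vertex_disc sE tE.
    by move=> h1 h2 h3; nra.
  move/eqP; rewrite mulf_eq0 !subr_eq0 => /orP[] /eqP ?.
    by exists b.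
  by exists (- b); rewrite ?coshN.
exists a, b' => k n ckn; apply: cosh_label => //.
- by move=> k1 n1 k2 n2; exact: edge_relation.
- by move=> x y; rewrite /mstar fracNN.
Qed.

End Labels.

(** * Representatives of the points of P^1(Q) *)

Section Fractions.

Lemma frac_numden (q : rat) : Defs.frac (numq q) (denq q) = Some q.
Proof. by rewrite /Defs.frac denq_eq0 divq_num_den. Qed.

Lemma coprimez_num_den (q : rat) : coprimez (numq q) (denq q).
Proof. by rewrite coprimezE rat.coprime_num_den. Qed.

Lemma fracP (p : option rat) : exists k n, coprimez k n /\ p = Defs.frac k n.
Proof.
case: p => [q|]; last by exists 1, 0.
exists (numq q), (denq q); split; first exact: coprimez_num_den.
by rewrite frac_numden.
Qed.

Lemma eq_frac (k n k' n' : int) : coprimez k n -> coprimez k' n' ->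
  k * n' = k' * n -> Defs.frac k n = Defs.frac k' n'.
Proof.
rewrite /Defs.frac !coprimezE; have [->|n0] := eqVneq n 0; have [->|n'0] := eqVneq n' 0 => //.
- by rewrite absz0 /coprime gcdn0; nia.
- by rewrite absz0 /coprime gcdn0; nia.
- move=> _ _ e; congr Some; apply/eqP.
  by rewrite eqr_div ?intr_eq0 // -!intrM e.
Qed.

Lemma ratr_frac (R : realType) (q : rat) :
  ratr q = (numq q)%:~R / (denq q)%:~R :> R.
Proof. by []. Qed.

End Fractions.

(** * Density of the rationals and equality of limits *)

Section Density.
Context {R : realType}.

(** Limits along the trace on [D] of the neighbourhoods of [x] are unique in a Hausdorff space.
    Working within [D] serves functions continuous on [0, 1] as well as on the whole line. *)
Lemma cvg_eq_closure (T U : topologicalType) (D : set T) (f g : T -> U) (x : T) :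
  hausdorff_space U -> closure D x ->
  f @ within D (nbhs x) --> f x -> g @ within D (nbhs x) --> g x ->
  (forall y, D y -> f y = g y) -> f x = g x.
Proof.
move=> hU clD fx gx fg; apply: hU => P Q /fx nP /gx nQ.
have {}nP : nbhs x [set y | D y -> P (f y)] by exact: nP.
have {}nQ : nbhs x [set y | D y -> Q (g y)] by exact: nQ.
have [y [Dy [Py Qy]]] := clD _ (filterI nP nQ).
by exists (f y); split; [exact: Py | rewrite fg //; exact: Qy].
Qed.

Lemma closure_rat (x : R) : closure (range (@ratr R)) x.
Proof.
move=> B /nbhs_ballP[e /= e0 sB].
have [q] : exists q, ratr q \in `]x, x + e[ by apply: rat_in_itvoo; lra.
rewrite in_itv /= => /andP[xq qx]; exists (ratr q); split; first by exists q.
by apply: sB; rewrite /ball /= ltr_distl; lra.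
Qed.

Lemma closure_rat01 (x : R) : 0 <= x <= 1 ->
  closure [set y : R | 0 <= y <= 1 /\ exists q, y = ratr q] x.
Proof.
move=> /andP[x0 x1] B /nbhs_ballP[e /= e0 sB].
(* Cutting the ball down to ]0, 1[ leaves a nonempty interval even when [x] is 0 or 1. *)
have uv : Num.max 0 (x - e) < Num.min 1 (x + e).
  by rewrite lt_min !gt_max; apply/andP; split; apply/andP; split; lra.
have [q] := rat_in_itvoo uv.
rewrite in_itv /= gt_max lt_min => /andP[/andP[q0 xq] /andP[q1 qx]].
exists (ratr q); split; first by split; [lra | exists q].
by apply: sB; rewrite /ball /= ltr_distl; lra.
Qed.

End Density.

(** * Polar coordinates and rational directions *)

Section Polar.
Context {R : realType}.

Lemma polar_form (x y : R) : (x, y) != (0, 0) -> exists a d : R,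
  0 < d /\ (x, y) = (d * cos a, d * sin a).
Proof.
move=> xy0; pose d := Num.sqrt (x ^+ 2 + y ^+ 2).
have s0 : 0 < x ^+ 2 + y ^+ 2.
  rewrite lt0r paddr_eq0 ?sqr_ge0 // !sqrf_eq0 addr_ge0 ?sqr_ge0 // andbT.
  by apply: contra xy0 => /andP[/eqP -> /eqP ->].
have d0 : 0 < d by rewrite sqrtr_gt0.
have dE : d ^+ 2 = x ^+ 2 + y ^+ 2 by rewrite sqr_sqrtr // ltW.
have xd : -1 <= x / d <= 1.
  rewrite ler_pdivlMr // ler_pdivrMr //; apply/andP.
  by split; have := sqr_ge0 y; nra.
have sE : d * sin (acos (x / d)) = `|y|.
  rewrite sin_acos // -[X in X * _ = _](ger0_norm (ltW d0)) -sqrtr_sqr -sqrtrM ?sqr_ge0 //.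
  rewrite -[RHS]sqrtr_sqr; congr Num.sqrt.
  have -> : d ^+ 2 * (1 - (x / d) ^+ 2) = d ^+ 2 - x ^+ 2.
    by field; rewrite lt0r_neq0.
  by rewrite dE; ring.
have cE : d * cos (acos (x / d)) = x.
  by rewrite acosK ?in_itv //= mulrC divfK ?lt0r_neq0.
(* The sine of an arccosine is nonnegative, so the sign of [y] decides between this angle and its
   opposite. *)
have [y0|y0] := leP 0 y.
  by exists (acos (x / d)), d; rewrite cE sE ger0_norm.
by exists (- acos (x / d)), d; rewrite cosN sinN mulrN cE sE ltr0_norm // opprK.
Qed.

(** The difference a - atan (tan a) is a multiple of pi, so adding atan q to it gives an angle of
    slope q, on the same side of the vertical axis as [a]. *)
Lemma rational_direction (a : R) (q : rat) : cos a != 0 ->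
  exists k n, coprimez k n /\
    has_direction (n%:~R, k%:~R) (a - atan (tan a) + atan (ratr q)).
Proof.
move=> ca0; pose p := atan (tan a); set t := _ + _; pose w := cos (atan (ratr q : R)).
have cos_atan_gt0 (x : R) : 0 < cos (atan x).
  by apply: cos_gt0_pihalf; rewrite atan_gtNpi2 atan_ltpi2.
have sin_atanE (x : R) : sin (atan x) = x * cos (atan x).
  by rewrite -{2}(atanK x) /tan divfK // lt0r_neq0.
have w0 : 0 < w by exact: cos_atan_gt0.
have sd : sin (a - p) = 0.
  by rewrite sinB /p sin_atanE /tan; field.
have cd : cos (a - p) ^+ 2 = 1.
  by rewrite -(cos2Dsin2 (a - p)) sd expr0n addr0.
have ct : cos t = cos (a - p) * w by rewrite /t cosD sd mul0r subr0.
have st : sin t = cos (a - p) * w * ratr q.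
  by rewrite /t sinD sd mul0r add0r sin_atanE mulrCA mulrC mulrA.
have qE : (numq q)%:~R = ratr q * (denq q)%:~R :> R.
  by rewrite ratr_frac divfK // intr_eq0 denq_eq0.
have n0 : 0 < (denq q)%:~R :> R by rewrite ltr0z.
have wd : w != 0 by rewrite lt0r_neq0.
have c0 : 0 < (denq q)%:~R / w by rewrite divr_gt0.
(* The parity of the multiple of pi selects one of the two opposite integer vectors of slope [q]. *)
move/eqP: cd; rewrite sqrf_eq1 => /orP[] /eqP cd; rewrite cd in ct st.
- exists (numq q), (denq q); split; first exact: coprimez_num_den.
  by exists ((denq q)%:~R / w) => //; rewrite ct st qE; congr pair; field.
- exists (- numq q), (- denq q); split.
    by rewrite coprimezE !abszN rat.coprime_num_den.
  by exists ((denq q)%:~R / w) => //; rewrite ct st !rmorphN /= qE; congr pair; field.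
Qed.

End Polar.

(** * The two lines, their polar radius and their encoding functions *)

Section Strip.
Context {R : realType}.
Variables a b : R.
Implicit Types (p : R * R) (t x : R).

(** Lattice points have coordinates proportional to (n, k), hence the order of the coefficients:
    [ell] takes the value k a + n b at (n, k). *)
Let ell p : R := b * p.1 + a * p.2.

Definition strip_boundary : set (R * R) := line b a (-1) `|` line b a 1.

Lemma strip_boundaryE p : strip_boundary p <-> `|ell p| = 1.
Proof.
split=> [[]/= e|/eqP]; rewrite /ell ?e ?normrN ?normr1 //.
by rewrite eqr_norml ler01 andbT => /orP[] /eqP; [right|left].
Qed.

(** By homogeneity, d (cos t, sin t) satisfies |ell| = 1 for d the inverse of |ell (cos t, sin t)|;
    a ray on which [ell] vanishes never meets the lines. *)
Definition strip_radius t : \bar R :=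
  if ell (cos t, sin t) == 0 then +oo%E else (`|ell (cos t, sin t)|^-1)%:E.

Definition strip_encoding (i : 'I_4) x : R := `|ell (sector i x)|.

Let ellZ c x y : ell (c * x, c * y) = c * ell (x, y).
Proof. by rewrite /ell /=; ring. Qed.

Let ell_cont : continuous (fun t => ell (cos t, sin t)).
Proof.
move=> t; apply: cvgD; apply: cvgM; first exact: cvg_cst.
- exact: continuous_cos.
- exact: cvg_cst.
- exact: continuous_sin.
Qed.

Lemma strip_radius_continuous : continuous strip_radius.
Proof.
move=> t; have ct := ell_cont t; rewrite /strip_radius.
have [e0|e0] := eqVneq (ell (cos t, sin t)) 0.
(* In a direction parallel to the lines the radius must tend to +oo. Taking [B] positive and at
   least [A] allows the condition |ell| < 1/B. *)
- rewrite /continuous_at e0 eqxx; apply/cvgeyPgt => A; pose B := Num.max A 1.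
  have B0 : 0 < B by rewrite lt_max ltr01 orbT.
  have AB : A <= B by rewrite le_max lexx.
  move: ct; rewrite /continuous_at e0 => /cvgr0_norm_lt /(_ B^-1); rewrite invr_gt0 => /(_ B0).
  apply: filterS => x /= xB; case: eqVneq => [_|x0]; first exact: ltry.
  by rewrite lte_fin (le_lt_trans AB) // -[B]invrK ltf_pV2 // posrE ?invr_gt0 ?normr_gt0 //.
- rewrite /continuous_at (negPf e0).
  apply: (@cvg_trans _ ((fun x => (`|ell (cos x, sin x)|^-1)%:E) @ t)).
    apply: near_eq_cvg.
    have nz : \forall x \near t, ell (cos x, sin x) != 0.
      by exact: (cvgr_neq0 (ell (cos t, sin t)) ct e0).
    by apply: filterS nz => x /= /negPf ->.
  have gc : (fun x => `|ell (cos x, sin x)|^-1) @ t --> `|ell (cos t, sin t)|^-1.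
    by apply: cvgV; [rewrite normr_eq0 | apply: cvg_norm].
  have fg : \forall x \near t, (`|ell (cos x, sin x)|^-1)%:E \is a fin_num.
    by near=> x.
  exact: (cvg_EFin fg gc).
Unshelve. all: by end_near.
Qed.

Lemma strip_radius_polar : polar_radius strip_radius.
Proof.
split; first exact: strip_radius_continuous.
- move=> t; rewrite /strip_radius mulr_natl.
  by rewrite cosD2pi sinD2pi.
- move=> t; rewrite /strip_radius; case: eqVneq => // e0.
  by rewrite lte_fin invr_gt0 normr_gt0.
Qed.

Lemma finite_points_strip : (a, b) != (0, 0) ->
  finite_points strip_radius = strip_boundary.
Proof.
move=> ab0; apply/seteqP; split => [p|[x y]].
- move=> [t [d [+ ->]]]; rewrite strip_boundaryE ellZ /strip_radius.
  case: eqVneq => // e0 [<-].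
  by rewrite normrM normfV normr_id mulVf // normr_eq0.
- rewrite strip_boundaryE => xy1.
  have xy0 : (x, y) != (0, 0).
    apply/eqP => -[x0 y0]; move: xy1; rewrite x0 y0 /ell /= !mulr0 addr0 normr0.
    by move/eqP; rewrite eq_sym oner_eq0.
  have [t [d [d0 xyE]]] := polar_form _ _ xy0.
  exists t, d; split => //; move: xy1; rewrite xyE ellZ normrM gtr0_norm //.
  rewrite /strip_radius; case: eqVneq => [->|e0 de].
    by rewrite normr0 mulr0 => /eqP; rewrite eq_sym oner_eq0.
  congr EFin; apply: (mulIf (_ : `|ell (cos t, sin t)| != 0)); rewrite ?normr_eq0 //.
  by rewrite mulVf ?normr_eq0.
Qed.

Lemma strip_encoding_continuous i : continuous (strip_encoding i).
Proof.
move=> x; apply: cvg_norm; rewrite /ell.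
by case: i => -[|[|[|i]]] ?; rewrite /sector /=; apply: cvgD;
  apply: cvgM; try exact: cvg_cst; exact: cvg_id.
Qed.

(** Dividing by the coordinate of larger absolute value gives a ratio in [-1, 1], whose sign selects
    the sector. The sign of [c] accounts for the two opposite copies of each sector in the curve. *)
Lemma sector_cover x y : (x, y) != (0, 0) -> exists i t c,
  [/\ 0 <= t <= 1, c != 0 & (x, y) = (c * (sector i t).1, c * (sector i t).2)].
Proof.
move=> xy0.
have [yx|xy] := leP `|y| `|x|.
- have x0 : x != 0.
    apply: contra xy0 => /eqP x0; move: yx; rewrite x0 normr0 normr_le0 => /eqP ->.
    by rewrite eqxx.
  have : `|y / x| <= 1 by rewrite normrM normfV ler_pdivrMr ?normr_gt0 // mul1r.
  rewrite ler_norml => /andP[l u]; have [t0|t0] := leP 0 (y / x).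
  + exists (Ordinal (isT : 1 < 4)%N), (y / x), x; rewrite /= t0 u; split=> //.
    by congr pair; field.
  + exists (Ordinal (isT : 2 < 4)%N), (- (y / x)), (- x); rewrite /= oppr_eq0; split=> //.
      by apply/andP; split; lra.
    by congr pair; field.
- have y0 : y != 0 by rewrite -normr_gt0 (le_lt_trans _ xy).
  have : `|x / y| <= 1 by rewrite normrM normfV ler_pdivrMr ?normr_gt0 // mul1r ltW.
  rewrite ler_norml => /andP[l u]; have [t0|t0] := leP 0 (x / y).
  + exists (Ordinal (isT : 0 < 4)%N), (x / y), y; rewrite /= t0 u; split=> //.
    by congr pair; field.
  + exists (Ordinal (isT : 3 < 4)%N), (- (x / y)), (- y); rewrite /= oppr_eq0; split=> //.
      by apply/andP; split; lra.
    by congr pair; field.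
Qed.

Lemma lattice_curve_strip : lattice_curve strip_encoding = strip_boundary.
Proof.
apply/seteqP; split => [p|[x y]].
- move=> [i [x _ [e0 pE]]]; apply/strip_boundaryE.
  set q := (_, _) in pE.
  have q1 : `|ell q| = 1.
    rewrite /q ![_ / strip_encoding i x]mulrC ellZ -surjective_pairing.
    by rewrite normrM normfV /strip_encoding normr_id mulVf.
  case: pE => -> //; rewrite -q1 -normrN; congr (`|_|).
  by rewrite /ell /=; ring.
- move/strip_boundaryE => xy1.
  have xy0 : (x, y) != (0, 0).
    apply/eqP => -[x0 y0]; move: xy1; rewrite x0 y0 /ell /= !mulr0 addr0 normr0.
    by move/eqP; rewrite eq_sym oner_eq0.
  have [i [t [c [t01 c0 xyE]]]] := sector_cover _ _ xy0.
  move: xy1; rewrite xyE ellZ -surjective_pairing normrM -/(strip_encoding i t) => ce.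
  have e0 : strip_encoding i t != 0.
    by apply/eqP => e0; move: ce; rewrite e0 mulr0 => /eqP; rewrite eq_sym oner_eq0.
  exists i; exists t => //; split=> //=.
  (* The curve rescales the sector point by this inverse, so (x, y) is that point or its opposite
     according to the sign of [c]. *)
  have eE : (strip_encoding i t)^-1 = `|c|.
    by apply: (mulIf e0); rewrite mulVf // ce.
  rewrite eE; have [c1|c1] := ger0P c.
    by left; congr pair; rewrite mulrC.
  by right; congr pair; rewrite /= mulrN opprK mulrC.
Qed.

End Strip.

(** * Uniqueness of the continuous extensions *)

Section Uniqueness.
Context {R : realType}.
Implicit Types (G : farey_topograph R).

Lemma encoding_functions_unique G Phi Psi :
  encoding_functions G Phi -> encoding_functions G Psi ->
  forall i x, 0 <= x <= 1 -> Psi i x = Phi i x.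
Proof.
move=> PhiG PsiG i x x01; have [cPhi PhiE] := PhiG i; have [cPsi PsiE] := PsiG i.
have sub : [set y : R | 0 <= y <= 1 /\ exists q, y = ratr q] `<=` `[0, 1].
  by move=> y [y01 _] /=; rewrite in_itv.
have x01' : `[0, 1]%classic x by rewrite /= in_itv.
have cvgD (f : R -> R) : {within `[0, 1], continuous f} ->
    f @ within [set y : R | 0 <= y <= 1 /\ exists q, y = ratr q] (nbhs x) --> f x.
  move=> /subspace_continuousP /(_ x x01') cf P /cf nP.
  have {}nP : nbhs x [set y | `[0, 1]%classic y -> P (f y)] by exact: nP.
  by apply: (filterS _ nP) => y h Dy; apply: h; exact: sub.
apply: (cvg_eq_closure _ _ _ _ _ _ (@Rhausdorff R) (closure_rat01 _ x01)).
- exact: cvgD.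
- exact: cvgD.
- move=> y [y01 [q qE]].
  have n0 : 0 < denq q by exact: denq_gt0.
  move: y01; rewrite qE ratr_frac ler_pdivrMr ?ler_pdivlMr ?ltr0z // mul0r mul1r ler0z ler_int.
  by move=> kn; rewrite PhiE ?PsiE // coprimez_num_den.
Qed.

Lemma polar_extension_unique G rad rad' :
  polar_extension G rad -> polar_extension G rad' -> rad' = rad.
Proof.
move=> [[crad _ _] radE] [[crad' _ _] rad'E]; apply/funext => t.
(* Vertical directions have no slope, but they are those of (0, 1) and (0, -1), where the value is
   prescribed. *)
have [ct0|ct0] := eqVneq (cos t) 0.
  have st1 : sin t ^+ 2 = 1 by rewrite -(cos2Dsin2 t) ct0 expr0n add0r.
  move/eqP: st1; rewrite sqrf_eq1 => /orP[] /eqP st.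
    have d : has_direction ((0 : int)%:~R, (1 : int)%:~R) t.
      by exists 1 => //; rewrite ct0 st mulr0 mulr1.
    by rewrite (radE _ _ _ _ d) ?(rad'E _ _ _ _ d).
  have d : has_direction ((0 : int)%:~R, (-1 : int)%:~R) t.
    by exists 1 => //; rewrite ct0 st mulr0 mul1r.
  by rewrite (radE _ _ _ _ d) ?(rad'E _ _ _ _ d).
(* [h] parametrizes by slope the directions of the open half plane containing [t]; rational slopes
   give lattice directions. *)
pose h x := t - atan (tan t) + atan x.
have hc : continuous h.
  by move=> x; apply: cvgD; [exact: cvg_cst | exact: continuous_atan].
have ht : h (tan t) = t by rewrite /h subrK.
have cvgD (f : R -> \bar R) : continuous f ->
    f \o h @ within (range (@ratr R)) (nbhs (tan t)) --> (f \o h) (tan t).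
  move=> cf; apply: cvg_within_filter.
  by apply: continuous_comp; [exact: hc | exact: cf].
rewrite -ht -[LHS]/((rad' \o h) _) -[RHS]/((rad \o h) _).
apply: (cvg_eq_closure _ _ _ _ _ _ (@ereal_hausdorff R) (closure_rat _)).
- exact: cvgD.
- exact: cvgD.
- move=> _ [q _ <-] /=; have [k [n [ckn d]]] := rational_direction _ q ct0.
  by rewrite (radE _ _ _ ckn d) (rad'E _ _ _ ckn d).
Qed.

End Uniqueness.

(** * The explicit curve extends the lattice points; uniqueness of the 2-region *)

Section Extension.
Context {R : realType}.
Variables (G : farey_topograph R) (a b : R).
Hypothesis GE : forall k n : int, coprimez k n ->
  mstar G k n = 2 * cosh (k%:~R * a + n%:~R * b).

Lemma rho_mstar k n : coprimez k n -> rho `|mstar G k n| = `|k%:~R * a + n%:~R * b|.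
Proof.
move=> ckn; rewrite GE // ger0_norm ?rho_2cosh //.
by rewrite mulr_ge0 // ltW // cosh_gt0.
Qed.

Lemma strip_encoding_functions : encoding_functions G (strip_encoding a b).
Proof.
move=> i; split.
  by apply: continuous_subspaceT; exact: strip_encoding_continuous.
move=> k n /andP[k0 kn] n0 ckn.
have nR : n%:~R != 0 :> R by rewrite intr_eq0 gt_eqF.
have nR' : `|n%:~R| = n%:~R :> R by rewrite ger0_norm // ler0z ltW.
have cnk : coprimez n k by rewrite /coprimez gcdzC.
have cnegk : coprimez (- k) n by rewrite coprimezE abszN -coprimezE.
have cnegn : coprimez (- n) k by rewrite coprimezE abszN -coprimezE.
(* Writing n as |n| brings the division inside the absolute value, where it is linear. *)
rewrite /phi /strip_encoding /sector -[n%:~R in RHS]nR'.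
case: i => -[|[|[|i]]] ? /=; rewrite rho_mstar // -normfV -normrM.
- by congr (`|_|); field.
- by congr (`|_|); field.
(* The sector vector (-1, k/n) is opposite to (n, -k)/n, the vector of the index -k/n. *)
- by rewrite -normrN rmorphN /=; congr (`|_|); field.
- by rewrite rmorphN /=; congr (`|_|); field.
Qed.

Lemma strip_polar_extension : polar_extension G (strip_radius a b).
Proof.
split; first exact: strip_radius_polar.
move=> k n t ckn [c c0 [nE kE]].
rewrite /strip_radius /lattice_dist /lattice_point rho_mstar // nE kE /=.
(* The vector (n, k) has length c and its label has rho equal to c |e|, with e the value of the form
   at (cos t, sin t); the factor c cancels in the distance. *)
have -> : c * sin t * a + c * cos t * b = c * (b * cos t + a * sin t) by ring.
rewrite normrM (gtr0_norm c0) mulf_eq0 (gt_eqF c0) /= normr_eq0.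
case: eqVneq => // e0; congr EFin.
set e := _ + _ in e0 *.
rewrite /euclidean_norm /=.
have -> : (c * cos t / (c * `|e|)) ^+ 2 + (c * sin t / (c * `|e|)) ^+ 2 =
    (`|e|^-1) ^+ 2 * (cos t ^+ 2 + sin t ^+ 2).
  by field; rewrite normr_eq0 e0 gt_eqF.
by rewrite cos2Dsin2 mulr1 sqrtr_sqr normfV normr_id.
Qed.

(** Label 2 means k a + n b = 0. Two index vectors in the kernel of a nonzero form have determinant
    zero: by Cramer, [d] annihilates both [a] and [b]. *)
Lemma label2_unique : (a, b) != (0, 0) ->
  forall p q, label G p = 2 -> label G q = 2 -> p = q.
Proof.
move=> ab0 p q.
have [k [n [ckn ->]]] := fracP p; have [k' [n' [ckn' ->]]] := fracP q.
have ker k1 n1 : coprimez k1 n1 -> label G (Defs.frac k1 n1) = 2 ->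
    k1%:~R * a + n1%:~R * b = 0.
  move=> c1 e; have := rho_mstar _ _ c1; rewrite /mstar e.
  have -> : `|2 : R| = 2 * cosh 0 by rewrite cosh0 mulr1 normr_nat.
  by rewrite rho_2cosh normr0 => /esym /eqP; rewrite normr_eq0 => /eqP.
move=> /(ker _ _ ckn) e /(ker _ _ ckn') e'; apply: eq_frac => //.
apply/eqP; rewrite -(eqr_int R) !intrM -subr_eq0.
set d := _ - _.
have da : d * a = 0.
  have -> : d * a = n'%:~R * (k%:~R * a + n%:~R * b) - n%:~R * (k'%:~R * a + n'%:~R * b).
    by rewrite /d; ring.
  by rewrite e e' !mulr0 subrr.
have db : d * b = 0.
  have -> : d * b = k%:~R * (k'%:~R * a + n'%:~R * b) - k'%:~R * (k%:~R * a + n%:~R * b).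
    by rewrite /d; ring.
  by rewrite e e' !mulr0 subrr.
apply: contraNT ab0 => d0; move/eqP: da; move/eqP: db.
by rewrite !mulf_eq0 (negPf d0) /= => /eqP -> /eqP ->.
Qed.

End Extension.

Theorem theorem11p5 (R : realType) (G : farey_topograph R)
  (label_ge2 : forall q : option rat, 2 <= label G q)
  (disc4 : discriminator G = 4)
  (not_all2 : ~ (forall q : option rat, label G q = 2)) :
  (forall p q : option rat, label G p = 2 -> label G q = 2 -> p = q) /\
  exists Phi : 'I_4 -> R -> R,
    [/\ encoding_functions G Phi,
        forall Psi : 'I_4 -> R -> R, encoding_functions G Psi ->
          forall (i : 'I_4) (x : R), 0 <= x <= 1 -> Psi i x = Phi i x,
        exists rad : R -> \bar R,
          [/\ polar_extension G rad,
              forall rad' : R -> \bar R, polar_extension G rad' -> rad' = rad &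
              finite_points rad = lattice_curve Phi] &
        parallel_lines_around_origin (lattice_curve Phi)].
Proof.
have [a [b GE]] := disc4_label _ (label_ge2 _) (label_ge2 _) disc4.
have ab0 : (a, b) != (0, 0).
  (* With a = b = 0 every label would be 2 cosh 0 = 2. *)
  apply/eqP => -[a0 b0]; apply: not_all2 => q.
  have [k [n [ckn ->]]] := fracP q.
  by rewrite -/(mstar _ _ _) GE // a0 b0 !mulr0 addr0 cosh0 mulr1.
split; first exact: (label2_unique _ _ _ GE).
have encG := strip_encoding_functions _ _ _ GE.
have radG := strip_polar_extension _ _ _ GE.
exists (strip_encoding a b); split => //.
- by move=> Psi; exact: encoding_functions_unique.
- exists (strip_radius a b); split => //.
    by move=> rad'; exact: polar_extension_unique.
  by rewrite finite_points_strip // lattice_curve_strip.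
- exists b, a, (-1), 1; split; last exact: lattice_curve_strip.
    by apply: contra ab0 => /eqP[-> ->].
  by rewrite ltrN10 ltr01.
Qed.
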